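(* Let $n\ge 3$ and let $K\subset\mathbb H^2$ be compact. There exists a compact set $K'=K'(K,n)\subset\mathbb H^2$, depending only on $K$ and $n$, with the following property: if $F(X,Z)$ is a stable, totally complex real binary form of degree $2n$ and more than half of its $n$ upper-half-plane roots, counted with multiplicity, lie in $K$ (equivalently, at least $m_0=\lfloor n/2\rfloor+1$ of the upper-half-plane roots lie in $K$), then $$\xi_{\mathcal J}(F)\in K' .$$
   Context: $\mathbb H^2=\{x+iy:y>0\}$ is the upper half-plane (with the hyperbolic metric). A real binary form of degree $2n$ is totally complex if it has no real roots (in $\mathbb P^1(\mathbb R)$); then $F(X,Z)=a_0\prod_{i=1}^n (X-\alpha_iZ)(X-\overline{\alpha_i}Z)$ with $a_0\in\mathbb R\setminus\{0\}$, and $\alpha_1,\ldots,\alpha_n\in\mathbb H^2$ are its upper-half-plane roots (with multiplicity). A form of degree $N$ is stable if none of its roots has multiplicity at least $N/2$. Julia's zero $\xi_{\mathcal J}(F)$: let $\mathbb H^3=\{z+t\mathbf{j}: z\in\mathbb C,\ t>0\}$, with $\mathbb H^2\subset\mathbb H^3$ via $x+iy\mapsto x+y\mathbf{j}$, and for $w=z+t\mathbf{j}$, $\alpha\in\mathbb C$ put $d_H(w,\alpha)=\ln\frac{|z-\alpha|^2+t^2}{t}$. For stable $F$ with all complex roots $\beta_1,\ldots,\beta_{2n}$ (with multiplicity), $\xi_{\mathcal J}(F)$ is the unique point $w\in\mathbb H^3$ minimizing $\sum_{i=1}^{2n} d_H(w,\beta_i)$; for totally complex real $F$ it lies in $\mathbb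 H^2$. *)

(* Defs.v *)
From HB Require Import structures.
From mathcomp Require Import all_boot all_order all_algebra.
From mathcomp Require Import all_classical all_reals all_analysis.
From mathcomp Require Import complex.
(* The notations of mpoly clash with those of MathComp-Analysis. *)
From mathcomp Require mpoly.
Import -(notations) mpoly.
Import Order.TTheory GRing.Theory Num.Theory.
Import numFieldNormedType.Exports.

Set Implicit Arguments.
Unset Strict Implicit.
Unset Printing Implicit Defensive.

Local Open Scope classical_set_scope.
Local Open Scope ring_scope.
Local Open Scope complex_scope.

(* The alias R[i]^o of R[i] carries the topology of the modulus. The hyperbolic
   metric of the upper half-plane induces the corresponding subspace topology,
   so a compact subset of the half-plane is a compact subset of R[i]^o that is
   included in it. *)
Definition upper_half_plane (R : realType) : set R[i]^o :=
  [set z | 0 < complex.Im z].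

(* The point (z, t) stands for z + t j. *)
Definition upper_half_space (R : realType) : set (R[i] * R) :=
  [set w | 0 < w.2].

Definition embed_H2_H3 (R : realType) (z : R[i]^o) : R[i] * R :=
  ((complex.Re z)%:C, complex.Im z).

(* A binary form F(X, Z) is a polynomial in two variables, X being the variable
   of index 0 and Z the variable of index 1. *)
Definition binary_form (A : nzRingType) (N : nat) (F : mpoly 2 A) : Prop :=
  F \is ishomog1 N mdeg.

Definition pair_point (A : nzRingType) (x z : A) : 'I_2 -> A :=
  fun i => [:: x; z]`_i.

Definition totally_complex (R : realType) (F : mpoly 2 R) : Prop :=
  forall x z : R, (x, z) != (0, 0) -> meval (pair_point x z) F != 0.

(* F(P, Q), for P and Q in C[X] *)
Definition subst_form (R : realType) (F : mpoly 2 R) (P Q : {poly R[i]}) :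
    {poly R[i]} :=
  mmap (fun c : R => c%:C%:P) (pair_point P Q) F.

Definition dehom (R : realType) (F : mpoly 2 R) : {poly R[i]} :=
  subst_form F 'X 1.

(* The multiplicity in F of the points (a : 1) and (1 : 0) of P^1(C), computed
   in the affine charts Z = 1 and X = 1. *)
Definition root_mult (R : realType) (F : mpoly 2 R) (a : R[i]) : nat :=
  mup a (dehom F).

Definition root_mult_infty (R : realType) (F : mpoly 2 R) : nat :=
  mup 0 (subst_form F 1 'X).

(* The condition on F = 0 is needed because mup a 0 = 0. *)
Definition stable_form (R : realType) (N : nat) (F : mpoly 2 R) : Prop :=
  [/\ F != 0,
      forall a : R[i], (2 * root_mult F a < N)%N
    & (2 * root_mult_infty F < N)%N].

(* The roots in C of F(X, 1), repeated according to their multiplicities. *)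
Definition complex_roots (R : realType) (F : mpoly 2 R) : seq R[i] :=
  sval (closed_field_poly_normal (dehom F)).

Definition uhp_roots (R : realType) (F : mpoly 2 R) : seq R[i] :=
  [seq a <- complex_roots F | 0 < complex.Im a].

Definition d_H (R : realType) (w : R[i] * R) (a : R[i]) : R :=
  ln ((ComplexField.Normc.normc (w.1 - a) ^+ 2 + w.2 ^+ 2) / w.2).

Definition julia_sum (R : realType) (F : mpoly 2 R) (w : R[i] * R) : R :=
  \sum_(b <- complex_roots F) d_H w b.

Definition unique_minimizer (T : Type) (R : realType) (D : set T) (f : T -> R)
    (w : T) : Prop :=
  D w /\ forall w', D w' -> w' <> w -> f w < f w'.

(* The unique minimizer of julia_sum F in H^3. When there is none, the value is
   the point (0, 0), which lies outside H^3, so that xi_J F belongs to a subset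
   of H^3 only if the unique minimizer exists. *)
Definition xi_J (R : realType) (F : mpoly 2 R) : R[i] * R :=
  xget (0, 0) (unique_minimizer (@upper_half_space R) (julia_sum F)).

(* Main.v *)
Require Import Defs.
From HB Require Import structures.
From mathcomp Require Import all_boot all_order all_algebra.
From mathcomp Require Import all_classical all_reals all_analysis.
From mathcomp Require Import complex.
From mathcomp Require Import ring lra.
From mathcomp Require mpoly.
Import -(notations) mpoly.
Import Order.TTheory GRing.Theory Num.Theory.
Import numFieldNormedType.Exports.

(** The half-plane is coordinatized by pairs [p] with [0 < p.2], and [cosh2 p q]
    is [2 * cosh (d p q)] for the hyperbolic distance [d].

    A totally complex real form of degree [2 * n] has [n] roots [a] in the
    half-plane, and its other roots are their conjugates, so the function
    minimized by Julia's zero is a sum over conjugate pairs.  Rotating a point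
    of the half-space about the real axis onto its [foot] in the half-plane
    does not increase the contribution of a pair, and decreases it unless the
    point is already in the plane or [a] is the foot ([julia_kernel_pair]).
    By stability the [a] are not all equal, so any minimum lies in the plane
    ([julia_min]).  There the sum is, up to a constant,
    [2 * \sum_a ln (cosh2 p a)].

    Each [ln (cosh2 _ a)] is strictly convex along geodesics
    ([cosh2_midpoint]), hence the minimum is unique.  For the location, compare
    [p] with a base point [o].  By the triangle inequality [cosh2_triangle],
    when [p] goes far from [o] the factor of an arbitrary root is divided by
    [cosh2 p o] at most, whereas the factor of a root in [K] is multiplied by
    [cosh2 p o / B ^+ 2] at least, where [B] bounds [cosh2 _ o] on [K].  Roots
    in [K] being a strict majority, one full factor [cosh2 p o] is left over
    against at most [B ^+ (2 * n)] ([cosh2_prod_outside]).  So the value at [o]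
    beats all values outside the disc [cosh2 p o <= B ^+ (2 * n)], which is
    compact and depends only on [K] and [n] ([cosh2_prod_min]). *)

Local Open Scope classical_set_scope.
Local Open Scope ring_scope.
Local Open Scope complex_scope.

(** * Hyperbolic distance in the half-plane *)

(** Twice the hyperbolic cosine of the hyperbolic distance; the factor 2 makes
    it submultiplicative, see [cosh2_triangle]. *)
Definition cosh2 {R : realFieldType} (p q : R * R) : R :=
  ((p.1 - q.1) ^+ 2 + p.2 ^+ 2 + q.2 ^+ 2) / (p.2 * q.2).

Lemma cosh2C {R : realFieldType} (p q : R * R) : cosh2 p q = cosh2 q p.
Proof. by rewrite /cosh2 (mulrC p.2); congr (_ / _); ring. Qed.

Lemma cosh2_sub2 {R : realFieldType} (p q : R * R) : 0 < p.2 -> 0 < q.2 ->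
  cosh2 p q - 2 = ((p.1 - q.1) ^+ 2 + (p.2 - q.2) ^+ 2) / (p.2 * q.2).
Proof. by move=> p0 q0; rewrite /cosh2; field; rewrite !gt_eqF. Qed.

Lemma cosh2_ge2 {R : realFieldType} (p q : R * R) : 0 < p.2 -> 0 < q.2 ->
  2 <= cosh2 p q.
Proof.
move=> p0 q0; rewrite -subr_ge0 cosh2_sub2//.
by rewrite divr_ge0 ?addr_ge0 ?sqr_ge0// mulr_ge0 ?ltW.
Qed.

Lemma cosh2_gt2 {R : realFieldType} (p q : R * R) :
  0 < p.2 -> 0 < q.2 -> p != q -> 2 < cosh2 p q.
Proof.
move=> p0 q0 pq; rewrite -subr_gt0 cosh2_sub2//.
rewrite divr_gt0 ?mulr_gt0// lt_neqAle addr_ge0 ?sqr_ge0// andbT eq_sym.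
rewrite paddr_eq0 ?sqr_ge0// !sqrf_eq0 !subr_eq0.
apply: contra pq => /andP[/eqP p1 /eqP p2]; apply/eqP.
by rewrite [p]surjective_pairing [q]surjective_pairing p1 p2.
Qed.

Lemma cosh2_gt0 {R : realFieldType} (p q : R * R) : 0 < p.2 -> 0 < q.2 ->
  0 < cosh2 p q.
Proof. by move=> p0 q0; rewrite (lt_le_trans _ (cosh2_ge2 _ _ _ _)). Qed.

(** [2 cosh (s + t) <= (2 cosh s) (2 cosh t)], combined with the triangle
    inequality.  After clearing denominators, both are absorbed in the
    Lagrange identity
    [(A^2 + q^2) (B^2 + q^2) = (A B - q^2)^2 + q^2 (A + B)^2]. *)
Lemma cosh2_triangle {R : realFieldType} (p q r : R * R) :
  0 < p.2 -> 0 < q.2 -> 0 < r.2 -> cosh2 p r <= cosh2 p q * cosh2 q r.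
Proof.
case: p q r => [p1 p2] [q1 q2] [r1 r2] /= p0 q0 r0.
rewrite -subr_ge0.
have -> : cosh2 (p1, p2) (q1, q2) * cosh2 (q1, q2) (r1, r2)
    - cosh2 (p1, p2) (r1, r2) =
    (((p1 - q1) * (q1 - r1) - q2 ^+ 2) ^+ 2 +
     p2 ^+ 2 * ((q1 - r1) ^+ 2 + r2 ^+ 2) + r2 ^+ 2 * (p1 - q1) ^+ 2)
    / (p2 * q2 ^+ 2 * r2).
  by rewrite /cosh2 /=; field; rewrite !gt_eqF.
apply: divr_ge0; last by rewrite !mulr_ge0 ?sqr_ge0 ?ltW.
by rewrite !(sqr_ge0, addr_ge0, mulr_ge0).
Qed.

(** In the hyperboloid model, where [p] is the vector
    [(1, p.1, p.1^2 + p.2^2) / p.2], the number [cosh2 p q] is twice a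
    Lorentzian inner product, and the difference of the two sides is the square
    of the determinant of the three vectors. *)
Lemma cosh2_gram {R : realFieldType} (p q a : R * R) :
    0 < p.2 -> 0 < q.2 -> 0 < a.2 ->
  cosh2 p a ^+ 2 + cosh2 q a ^+ 2 + cosh2 p q ^+ 2 <=
  4 + cosh2 p q * (cosh2 p a * cosh2 q a).
Proof.
case: p q a => [p1 p2] [q1 q2] [a1 a2] /= p0 q0 a0.
rewrite -subr_ge0; set X := (X in 0 <= X).
have -> : X = (((q1 - p1) * (a1 ^+ 2 + a2 ^+ 2) +
    (p1 - a1) * (q1 ^+ 2 + q2 ^+ 2) + (a1 - q1) * (p1 ^+ 2 + p2 ^+ 2)) /
    (p2 * q2 * a2)) ^+ 2.
  by rewrite /X /cosh2 /=; field; rewrite !gt_eqF.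
exact: sqr_ge0.
Qed.

(** Strict geodesic convexity of [ln (cosh2 _ a)].  The point [m] is the
    hyperbolic midpoint, the normalized sum of the vectors of [p] and [q] in
    the hyperboloid model, so that [cosh2 _ a] is additive up to the
    normalization [c].  The claim becomes [P^2 + Q^2 < B P Q], which is
    [cosh2_gram] because [2 < B]. *)
Lemma cosh2_midpoint {R : rcfType} (p q : R * R) :
    0 < p.2 -> 0 < q.2 -> p != q ->
  exists2 m : R * R, 0 < m.2 & forall a : R * R, 0 < a.2 ->
    cosh2 m a ^+ 2 < cosh2 p a * cosh2 q a.
Proof.
move=> p0 q0 pq; have B2 := cosh2_gt2 _ _ p0 q0 pq.
set B := cosh2 p q in B2 *.
have B20 : 0 < 2 + B by lra.
have [c c0 c2] : exists2 c : R, 0 < c & c ^+ 2 = 2 + B.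
  by exists (Num.sqrt (2 + B)); rewrite ?sqrtr_gt0// sqr_sqrtr// ltW.
have pq0 : 0 < p.2 + q.2 by rewrite addr_gt0.
exists ((p.1 * q.2 + q.1 * p.2) / (p.2 + q.2), c * (p.2 * q.2) / (p.2 + q.2)).
  by rewrite /= !(mulr_gt0, invr_gt0).
move=> a a0; set m : R * R := (_, _).
have -> : cosh2 m a = (cosh2 p a + cosh2 q a) / c.
  (* [c] must occur squared in the numerator to be eliminated by [c2]. *)
  have -> : cosh2 m a = ((m.1 - a.1) ^+ 2 +
      c ^+ 2 * (p.2 * q.2 / (p.2 + q.2)) ^+ 2 + a.2 ^+ 2) / (m.2 * a.2).
    by rewrite /cosh2 /m /=; congr (_ / _); field; rewrite gt_eqF.
  by rewrite c2 /B /cosh2 /m /=; field; rewrite !gt_eqF.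
have P0 := cosh2_gt0 _ _ p0 a0; have Q0 := cosh2_gt0 _ _ q0 a0.
have gram := cosh2_gram _ _ _ p0 q0 a0; rewrite -/B in gram.
rewrite [ltLHS]expr_div_n c2 ltr_pdivrMr//.
move: (cosh2 p a) (cosh2 q a) P0 Q0 gram => P Q P0 Q0 gram.
nra.
Qed.

(** * The product of hyperbolic cosines and its minimum *)

Definition cosh2_prod {R : realFieldType} (v : seq (R * R)) (p : R * R) : R :=
  \prod_(a <- v) cosh2 p a.

Lemma cosh2_prod_gt0 {R : realFieldType} (v : seq (R * R)) (p : R * R) :
  {in v, forall a, 0 < a.2} -> 0 < p.2 -> 0 < cosh2_prod v p.
Proof.
move=> v0 p0; rewrite /cosh2_prod big_seq prodr_gt0// => a /v0 a0.
exact: cosh2_gt0.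
Qed.

Lemma cosh2_prod_midpoint {R : rcfType} (v : seq (R * R)) (p q : R * R) :
    {in v, forall a, 0 < a.2} -> (0 < size v)%N ->
    0 < p.2 -> 0 < q.2 -> p != q ->
  exists2 m : R * R, 0 < m.2 &
    cosh2_prod v m ^+ 2 < cosh2_prod v p * cosh2_prod v q.
Proof.
move=> v0 sv p0 q0 pq; have [m m0 mP] := cosh2_midpoint p q p0 q0 pq.
exists m => //; rewrite /cosh2_prod -prodrXl -big_split /= !big_seq.
apply: ltr_prod => [|a /v0 a0]; last by rewrite sqr_ge0 mP.
by case: v sv {v0} => //= a v _; rewrite mem_head.
Qed.

(** The bookkeeping of the localization: going from [o] to [p], a factor whose
    root satisfies [P] is multiplied by [cosh2 p o / B ^+ 2] at least, and any
    other factor is divided by [cosh2 p o] at most. *)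
Lemma cosh2_prod_compare {R : realFieldType} (v : seq (R * R))
    (P : pred (R * R)) (B : R) (p o : R * R) :
    {in v, forall a, 0 < a.2} -> {in v, forall a, P a -> cosh2 a o <= B} ->
    0 < p.2 -> 0 < o.2 ->
  cosh2_prod v o * cosh2 p o ^+ count P v <=
  cosh2_prod v p * (B ^+ (2 * count P v) * cosh2 p o ^+ count (predC P) v).
Proof.
move=> v0 vB p0 o0; elim: v v0 vB => [|a v IH] v0 vB.
  by rewrite /cosh2_prod !big_nil /= !expr0 !mulr1.
have a0 : 0 < a.2 by rewrite v0 ?mem_head.
have {}IH : cosh2_prod v o * cosh2 p o ^+ count P v <=
  cosh2_prod v p * (B ^+ (2 * count P v) * cosh2 p o ^+ count (predC P) v).
  by apply: IH => b bv; [apply: v0|apply: vB]; rewrite inE bv orbT.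
have {}v0 : {in v, forall a, 0 < a.2}.
  by move=> b bv; apply: v0; rewrite inE bv orbT.
have E0 := cosh2_gt0 _ _ p0 o0.
have Pa0 := cosh2_gt0 _ _ p0 a0; have Oa0 := cosh2_gt0 _ _ o0 a0.
have prod_cons q : cosh2_prod (a :: v) q = cosh2 q a * cosh2_prod v q.
  by rewrite /cosh2_prod big_cons.
rewrite !prod_cons /=.
have V0 := ltW (cosh2_prod_gt0 _ _ v0 o0).
have [Pa|nPa] /= := boolP (P a); rewrite ?add1n ?add0n.
  have {}vB : cosh2 o a <= B by rewrite cosh2C vB ?mem_head.
  have B0 : 0 < B by exact: lt_le_trans vB.
  have le1 : cosh2 o a * cosh2 p o <= cosh2 p a * B ^+ 2.
    have tri := cosh2_triangle p a o p0 a0 o0; rewrite (cosh2C a) in tri.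
    apply: (@le_trans _ _ (cosh2 o a * (cosh2 p a * cosh2 o a))).
      by apply: ler_wpM2l tri; exact: ltW.
    rewrite mulrCA; apply: ler_wpM2l; first exact: ltW.
    by rewrite expr2 ler_pM// ltW.
  rewrite exprS mulnS exprD.
  rewrite (_ : _ * _ = (cosh2 o a * cosh2 p o) *
     (cosh2_prod v o * cosh2 p o ^+ count P v)); last by ring.
  rewrite (_ : cosh2 p a * _ * _ = (cosh2 p a * B ^+ 2) *
    (cosh2_prod v p * (B ^+ (2 * count P v) * cosh2 p o ^+ count (predC P) v)));
    last by ring.
  apply: ler_pM => //; first exact/ltW/mulr_gt0.
  by rewrite mulr_ge0// exprn_ge0// ltW.
have le1 : cosh2 o a <= cosh2 p a * cosh2 p o.
  by rewrite mulrC (cosh2C p o) cosh2_triangle.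
rewrite exprS.
rewrite -mulrA (_ : cosh2 p a * _ * _ = (cosh2 p a * cosh2 p o) *
    (cosh2_prod v p * (B ^+ (2 * count P v) * cosh2 p o ^+ count (predC P) v)));
    last by ring.
apply: ler_pM => //; first exact: ltW.
by rewrite mulr_ge0// exprn_ge0// ltW.
Qed.

(** Since the roots satisfying [P] outnumber the others, at least one power of
    [cosh2 p o] survives in [cosh2_prod_compare], and it exceeds the accumulated
    powers of [B]. *)
Lemma cosh2_prod_outside {R : realFieldType} (v : seq (R * R))
    (P : pred (R * R)) (B : R) (p o : R * R) :
    {in v, forall a, 0 < a.2} -> {in v, forall a, P a -> cosh2 a o <= B} ->
    1 <= B -> (size v < 2 * count P v)%N -> 0 < p.2 -> 0 < o.2 ->
    B ^+ (2 * size v) < cosh2 p o ->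
  cosh2_prod v o < cosh2_prod v p.
Proof.
move=> v0 vB B1 maj p0 o0 far.
have cmp := cosh2_prod_compare _ _ _ _ _ v0 vB p0 o0.
have E2 := cosh2_ge2 _ _ p0 o0.
have E1 : 1 <= cosh2 p o by lra.
have E0 : 0 < cosh2 p o by lra.
have V0 := cosh2_prod_gt0 _ _ v0 o0; have B0 : 0 < B by lra.
move: cmp far maj; rewrite -(count_predC P v).
set k := count P v; set l := count (predC P) v => cmp far maj.
have lk : (l < k)%N by rewrite mul2n -addnn ltn_add2l in maj.
have lt1 : B ^+ (2 * k) * cosh2 p o ^+ l < cosh2 p o ^+ k.
  apply: (@lt_le_trans _ _ (cosh2 p o * cosh2 p o ^+ l)).
    rewrite ltr_pM2r ?exprn_gt0// (le_lt_trans _ far)//.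
    by rewrite ler_weXn2l// leq_mul2l leq_addr.
  by rewrite -exprS ler_weXn2l.
rewrite -(ltr_pM2r (_ : 0 < B ^+ (2 * k) * cosh2 p o ^+ l)); last first.
  by rewrite mulr_gt0 ?exprn_gt0.
by apply: lt_le_trans cmp; rewrite ltr_pM2l.
Qed.

(** The closed hyperbolic disc [cosh2 p (0, 1) <= T] of centre [(0, 1)].
    Without the denominator this is a closed condition on the whole plane, which
    forces [0 < p.2] by itself when [0 < T]. *)
Definition hdisc {R : realType} (T : R) : set (R * R) :=
  [set p | p.1 ^+ 2 + p.2 ^+ 2 + 1 <= T * p.2].

Lemma hdisc_gt0 {R : realType} (T : R) (p : R * R) :
  0 < T -> hdisc T p -> 0 < p.2.
Proof.
move=> T0; rewrite /hdisc /= => h; rewrite -(pmulr_rgt0 _ T0).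
by apply: lt_le_trans h; rewrite ltr_wpDl// addr_ge0 ?sqr_ge0.
Qed.

Lemma hdisc_cosh2 {R : realType} (T : R) (p : R * R) : 0 < p.2 ->
  cosh2 p (0, 1) <= T -> hdisc T p.
Proof.
move=> p0; rewrite /cosh2 /hdisc /= mulr1 subr0 expr1n.
by rewrite ler_pdivrMr.
Qed.

Lemma compact_hdisc {R : realType} (T : R) : compact (hdisc T).
Proof.
pose box := `[- `|T|, `|T|] `*` `[- `|T|, `|T|].
apply: (@subclosed_compact _ _ box); last 1 first.
- move=> [x y]; rewrite /hdisc /box /= => h.
  have boxP z : z ^+ 2 <= T ^+ 2 -> z \in `[- `|T|, `|T|].
    by move=> zT; rewrite in_itv /= -ler_norml -!sqrtr_sqr ler_wsqrtr.
  have Tp := sqr_ge0 (T - y); have x2 := sqr_ge0 x; have y2 := sqr_ge0 y.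
  by split; apply: boxP; nra.
- have -> : hdisc T = (fun p : R * R =>
      T * p.2 - (p.1 ^+ 2 + p.2 ^+ 2 + 1)) @^-1` [set x | 0 <= x].
    by apply/seteqP; split=> p; rewrite /hdisc /= subr_ge0.
  apply: closed_comp; last exact: closed_ge.
  move=> p _.
  have c1 : q.1 @[q --> p] --> p.1 by exact: cvg_fst.
  have c2 : q.2 @[q --> p] --> p.2 by exact: cvg_snd.
  by apply: cvgB; [apply: cvgM c2; exact: cvg_cst|
    apply: cvgD; [apply: cvgD; rewrite ?expr2; apply: cvgM|exact: cvg_cst]].
- by apply: compact_setX; exact: segment_compact.
Qed.

Lemma continuous_cosh2 {R : realType} (a p : R * R) : p.2 != 0 -> a.2 != 0 ->
  {for p, continuous (fun p => cosh2 p a)}.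
Proof.
move=> p0 a0.
have c1 : q.1 @[q --> p] --> p.1 by exact: cvg_fst.
have c2 : q.2 @[q --> p] --> p.2 by exact: cvg_snd.
apply: cvgM; last first.
  apply: cvgV; first by rewrite mulf_neq0.
  by apply: cvgM => //; exact: cvg_cst.
apply: cvgD; last exact: cvg_cst.
by apply: cvgD; apply: cvgM => //; apply: cvgB => //; exact: cvg_cst.
Qed.

Lemma continuous_cosh2_prod {R : realType} (v : seq (R * R)) (p : R * R) :
    {in v, forall a, 0 < a.2} -> p.2 != 0 ->
  {for p, continuous (cosh2_prod v)}.
Proof.
move=> v0 p0; elim: v v0 => [|a v IH] v0.
  rewrite (_ : cosh2_prod _ = cst 1); first exact: cvg_cst.
  by apply/funext => q; rewrite /cosh2_prod big_nil.
rewrite (_ : cosh2_prod _ = (fun q => cosh2 q a * cosh2_prod v q)); last first.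
  by apply/funext => q; rewrite /cosh2_prod big_cons.
apply: cvgM.
  by apply: continuous_cosh2 => //; rewrite gt_eqF// v0 ?mem_head.
by apply: IH => b bv; apply: v0; rewrite inE bv orbT.
Qed.

(** A minimum over the compact disc is global because the centre of the disc
    already beats every point outside, and it is the only one because two
    minimizers would both be beaten at their midpoint. *)
Lemma cosh2_prod_min {R : realType} (v : seq (R * R)) (P : pred (R * R))
    (B T : R) :
    {in v, forall a, 0 < a.2} -> {in v, forall a, P a -> cosh2 a (0, 1) <= B} ->
    1 <= B -> (size v < 2 * count P v)%N ->
    2 <= T -> B ^+ (2 * size v) <= T ->
  exists2 p : R * R, hdisc T p &
    forall q : R * R, 0 < q.2 -> q != p -> cosh2_prod v p < cosh2_prod v q.
Proof.
move=> v0 vB B1 maj T2 BT; have T0 : 0 < T by lra.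
have oD : hdisc T (0, 1) by rewrite /hdisc /=; lra.
have sv : (0 < size v)%N by case: v maj {v0 vB BT}.
have [||p pD pmin] := @compact_EVT_min _ _ (cosh2_prod v) _ _ (compact_hdisc T).
- by exists (0, 1).
- apply/continuous_in_subspaceT => p; rewrite inE => pD.
  by apply: continuous_cosh2_prod => //; rewrite gt_eqF// (hdisc_gt0 _ _ T0 pD).
rewrite inE in pD; have p0 := hdisc_gt0 _ _ T0 pD.
have pglob q : 0 < q.2 -> cosh2_prod v p <= cosh2_prod v q.
  move=> q0; have [qT|Tq] := leP (cosh2 q (0, 1)) T.
    by rewrite pmin// inE; exact: hdisc_cosh2.
  rewrite (@le_trans _ _ (cosh2_prod v (0, 1)))//; first by rewrite pmin ?inE.
  rewrite ltW// (@cosh2_prod_outside _ _ P B)//=.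
  exact: le_lt_trans Tq.
exists p => // q q0 qp; rewrite lt_neqAle pglob// andbT; apply/eqP => pq.
have [m m0] := cosh2_prod_midpoint _ _ _ v0 sv p0 q0 (contra_neq esym qp).
rewrite -pq -expr2 ltNge lerXn2r ?nnegrE ?pglob//.
  exact: ltW (cosh2_prod_gt0 _ _ v0 p0).
exact: ltW (cosh2_prod_gt0 _ _ v0 m0).
Qed.

(** * Reduction from the half-space to the half-plane *)

Lemma ltr_prod_has {R : numDomainType} {I : eqType} (r : seq I)
    (E1 E2 : I -> R) (i : I) :
    {in r, forall j, 0 < E1 j <= E2 j} -> i \in r -> E1 i < E2 i ->
  \prod_(j <- r) E1 j < \prod_(j <- r) E2 j.
Proof.
move=> le12 ir lt12; have /andP[i0 _] := le12 i ir.
rewrite !(perm_big _ (perm_to_rem ir)) /= !big_cons.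
have {}le12 j : j \in rem i r -> 0 < E1 j <= E2 j by move=> /mem_rem /le12.
apply: (@lt_le_trans _ _ (E2 i * \prod_(j <- rem i r) E1 j)).
  rewrite ltr_pM2r// big_seq prodr_gt0// => j /le12.
  by case/andP.
apply: ler_wpM2l; first exact/ltW/(lt_trans i0).
rewrite ![\prod_(_ <- rem i r) _]big_seq ler_prod// => j /le12 /andP[j0 ->].
by rewrite ltW.
Qed.

(** The argument of the logarithm in [d_H]: comparing products of kernels
    instead of sums keeps logarithms out of the estimates. *)
Definition julia_kernel {R : realType} (w : R[i] * R) (b : R[i]) : R :=
  (ComplexField.Normc.normc (w.1 - b) ^+ 2 + w.2 ^+ 2) / w.2.

Definition of_coords {R : realType} (p : R * R) : R[i]^o := p.1 +i* p.2.
Definition coords {R : realType} (a : R[i]) : R * R :=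
  (complex.Re a, complex.Im a).

(** The point of the half-plane obtained from [w] by rotation about the real
    axis. *)
Definition foot {R : realType} (w : R[i] * R) : R * R :=
  (complex.Re w.1, Num.sqrt (complex.Im w.1 ^+ 2 + w.2 ^+ 2)).

Lemma julia_kernelE {R : realType} (x y t a b : R) :
  julia_kernel (x +i* y, t) (a +i* b) =
  ((x - a) ^+ 2 + (y - b) ^+ 2 + t ^+ 2) / t.
Proof. by rewrite /julia_kernel /= sqr_sqrtr// addr_ge0 ?sqr_ge0. Qed.

Lemma julia_kernel_gt0 {R : realType} (w : R[i] * R) (b : R[i]) :
  0 < w.2 -> 0 < julia_kernel w b.
Proof.
by move=> w0; rewrite divr_gt0// ltr_wpDl ?sqr_ge0// exprn_gt0.
Qed.

Lemma foot_gt0 {R : realType} (w : R[i] * R) : 0 < w.2 -> 0 < (foot w).2.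
Proof. by move=> w0; rewrite sqrtr_gt0 ltr_wpDl ?sqr_ge0// exprn_gt0. Qed.

(** The first summand is the value of the pair at the foot of [w], so the second
    is what is lost by leaving the plane.  With
    [A = (x - a)^2 + b^2 + s^2], the pair is [(A^2 - 4 y^2 b^2) / t^2] and its
    value at the foot is [A^2 / s^2]; the difference is
    [y^2 (A^2 - 4 b^2 s^2) / (t s)^2]. *)
Lemma julia_kernel_pair {R : realType} (w : R[i] * R) (a : R[i]) :
    0 < w.2 -> 0 < complex.Im a ->
  let s := (foot w).2 in
  julia_kernel w a * julia_kernel w (conjc a) =
  (complex.Im a * cosh2 (foot w) (coords a)) ^+ 2 +
  complex.Im w.1 ^+ 2 *
    ((complex.Re w.1 - complex.Re a) ^+ 2 + (s - complex.Im a) ^+ 2) *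
    ((complex.Re w.1 - complex.Re a) ^+ 2 + (s + complex.Im a) ^+ 2) /
    (w.2 * s) ^+ 2.
Proof.
move=> w0 a0 s; have s0 : 0 < s := foot_gt0 w w0.
have s2 : s ^+ 2 = complex.Im w.1 ^+ 2 + w.2 ^+ 2.
  by rewrite sqr_sqrtr// addr_ge0 ?sqr_ge0.
rewrite /cosh2 -/s /coords.
case: w a @s w0 a0 s0 s2 => [[x y] t] [a b] s /= w0 a0 s0 s2.
rewrite -/s !julia_kernelE opprK.
have y2 : y ^+ 2 = s ^+ 2 - t ^+ 2 by rewrite s2; ring.
move: (s) s0 s2 y2 => {}s s0 s2 y2.
have -> : ((x - a) ^+ 2 + (y - b) ^+ 2 + t ^+ 2) / t *
    (((x - a) ^+ 2 + (y + b) ^+ 2 + t ^+ 2) / t) =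
  (((x - a) ^+ 2 + b ^+ 2 + (y ^+ 2 + t ^+ 2)) ^+ 2 - 4 * y ^+ 2 * b ^+ 2) /
  t ^+ 2.
  by field; rewrite gt_eqF.
rewrite y2; field; rewrite !gt_eqF//.
Qed.

Lemma prod_conj_pairs {R : realType} (u : seq R[i]) (f : R[i] -> R) :
  \prod_(b <- u ++ map conjc u) f b = \prod_(a <- u) (f a * f (conjc a)).
Proof. by rewrite big_cat big_map big_split. Qed.

Lemma ln_prod_seq {R : realType} {I : Type} (r : seq I) (f : I -> R) :
  (forall i, 0 < f i) -> \sum_(i <- r) ln (f i) = ln (\prod_(i <- r) f i).
Proof.
move=> f0; elim: r => [|i r IH]; first by rewrite !big_nil ln1.
by rewrite !big_cons IH lnM ?posrE// prodr_gt0.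
Qed.

(** From the half-plane to the half-space: a point outside the plane is beaten
    by its foot, strictly because some root differs from the foot, and the foot
    does not beat [p]. *)
Lemma julia_min {R : realType} (s u : seq R[i]) (p : R * R) :
    perm_eq s (u ++ map conjc u) ->
    {in u, forall a, 0 < complex.Im a} ->
    (forall b, exists2 a, a \in u & a != b) ->
    0 < p.2 ->
    (forall q : R * R, 0 < q.2 -> q != p ->
      cosh2_prod (map coords u) p < cosh2_prod (map coords u) q) ->
  unique_minimizer (@upper_half_space R)
    (fun w => \sum_(b <- s) d_H w b) (embed_H2_H3 (of_coords p)).
Proof.
move=> su u0 uneq p0 pmin; split=> [|w]; first exact: p0.
rewrite /upper_half_space /= => w0 wp.
have sumE v : 0 < v.2 -> \sum_(b <- s) d_H v b =
    ln (\prod_(a <- u) (julia_kernel v a * julia_kernel v (conjc a))).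
  move=> v0; rewrite (perm_big _ su) /= -(prod_conj_pairs u (julia_kernel v)).
  by rewrite -ln_prod_seq// => b; exact: julia_kernel_gt0.
have prod0 v : 0 < v.2 ->
    0 < \prod_(a <- u) (julia_kernel v a * julia_kernel v (conjc a)).
  by move=> v0; rewrite prodr_gt0// => a _; rewrite mulr_gt0 ?julia_kernel_gt0.
rewrite !sumE// ltr_ln ?posrE ?prod0//.
pose K q := \prod_(a <- u) (complex.Im a * cosh2 q (coords a)) ^+ 2.
have KE q : K q =
    (\prod_(a <- u) complex.Im a) ^+ 2 * cosh2_prod (map coords u) q ^+ 2.
  rewrite /K /cosh2_prod big_map -!prodrXl -big_split /=.
  by apply: eq_bigr => a _; rewrite exprMn.
have C0 q : 0 < q.2 -> 0 < cosh2_prod (map coords u) q.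
  by move=> q0; apply: cosh2_prod_gt0 => // _ /mapP[a /u0 a0 ->].
have I0 : 0 < (\prod_(a <- u) complex.Im a) ^+ 2.
  by rewrite exprn_gt0// big_seq prodr_gt0.
have Klt q : 0 < q.2 -> q != p -> K p < K q.
  move=> q0 qp; rewrite !KE ltr_pM2l// ltrXn2r ?nnegrE ?pmin//; exact/ltW/C0.
have planeE q : 0 < q.2 ->
    \prod_(a <- u) (julia_kernel (embed_H2_H3 (of_coords q)) a *
      julia_kernel (embed_H2_H3 (of_coords q)) (conjc a)) = K q.
  move=> q0; rewrite /K !big_seq; apply: eq_bigr => a /u0 a0.
  rewrite julia_kernel_pair//= expr0n /= !mul0r addr0 /foot /= expr0n add0r.
  by rewrite sqrtr_sqr gtr0_norm//; case: (q).
rewrite planeE//.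
have f0 := foot_gt0 w w0.
have [wy|wy] := eqVneq (complex.Im w.1) 0.
  have wE : w = embed_H2_H3 (of_coords (foot w)).
    case: w w0 wp wy {f0} => [[x y] t] /= w0 _ ->.
    rewrite /embed_H2_H3 /of_coords /foot /= expr0n add0r sqrtr_sqr.
    by rewrite gtr0_norm.
  rewrite wE planeE// Klt//; apply/eqP => fp; apply: wp.
  by rewrite wE fp.
apply: (@le_lt_trans _ _ (K (foot w))).
  by have [->//|fp] := eqVneq (foot w) p; rewrite ltW// Klt.
have [a au afoot] := uneq (of_coords (foot w)).
have neq : (foot w) != coords a.
  apply: contra afoot => /eqP ->; rewrite /of_coords /coords /=; by case: (a).
have y0 : 0 < complex.Im w.1 ^+ 2.
  by rewrite lt_neqAle eq_sym sqrf_eq0 wy sqr_ge0.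
apply: (@ltr_prod_has _ _ _ _ _ a) => // [b bu|].
  have b0 := u0 _ bu.
  rewrite exprn_gt0 /=; last by rewrite (mulr_gt0 b0)// cosh2_gt0.
  rewrite julia_kernel_pair// lerDl divr_ge0 ?sqr_ge0//.
  by rewrite !(sqr_ge0, addr_ge0, mulr_ge0).
have a0 := u0 _ au.
rewrite julia_kernel_pair// ltrDl divr_gt0 ?exprn_gt0 ?(mulr_gt0 w0)//.
apply: mulr_gt0; first apply: mulr_gt0 => //.
  have := cosh2_gt2 _ _ f0 (a0 : 0 < (coords a).2) neq.
  rewrite -subr_gt0 cosh2_sub2// pmulr_lgt0; first exact.
  by rewrite invr_gt0 mulr_gt0.
by rewrite ltr_wpDl ?sqr_ge0// exprn_gt0// addr_gt0.
Qed.

(** * Compact sets of complex numbers *)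

Lemma continuous_coords {R : realType} :
  continuous (coords : R[i]^o -> R * R).
Proof.
move=> z A /nbhs_ballP[e /= e0 eA].
apply/(@nbhs_ballP _ R[i]^o); exists e%:C => /=; first by rewrite ltcR.
move=> w zw; apply: eA; move: zw.
rewrite -ball_normE /= /ball_ /=; case: z => x y; case: w => a b.
rewrite normc_def ltcR /= => xyab.
split; rewrite /= -ball_normE /ball_ /=; apply: le_lt_trans xyab;
  rewrite -sqrtr_sqr ler_wsqrtr// ?lerDl ?lerDr sqr_ge0//.
Qed.

Lemma continuous_of_coords {R : realType} :
  continuous (of_coords : R * R -> R[i]^o).
Proof.
move=> p A /(@nbhs_ballP _ R[i]^o)[e /= e0 eA].
have e2 : 0 < complex.Re e / 2 by move: e0; rewrite ltcE /= => /andP[_ e0]; lra.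
have eE : e = (complex.Re e)%:C.
  by case: e e0 {eA e2} => x y; rewrite ltcE /= => /andP[/eqP -> _].
apply/nbhs_ballP; exists (complex.Re e / 2) => // q pq; apply: eA; move: pq.
case: p q => [x y] [a b] [] /=; rewrite -!ball_normE /= /ball_ /= => xa yb.
rewrite eE normc_def ltcR /=.
set u := x - a in xa *; set v := y - b in yb *.
move: xa yb; rewrite !ltr_norml => /andP[u1 u2] /andP[v1 v2].
have er : 0 < complex.Re e by lra.
rewrite -[ltRHS]gtr0_norm// -[ltRHS]sqrtr_sqr ltr_sqrt ?exprn_gt0//.
nra.
Qed.

(** The quantity [B] through which the compact set holding the majority of the
    roots enters the localization. *)
Lemma compact_cosh2_bounded {R : realType} (K : set R[i]^o) (o : R * R) :
    compact K -> K `<=` @upper_half_plane R -> 0 < o.2 ->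
  exists2 B : R, 2 <= B & forall a, K a -> cosh2 (coords a) o <= B.
Proof.
move=> cK KU o0.
have [K0|/set0P/negP/negPn/eqP K0] := pselect (K !=set0); last first.
  by exists 2 => // a; rewrite K0.
pose f (a : R[i]^o) := cosh2 (coords a) o.
have [|a aK amax] := @compact_EVT_max _ _ f _ K0 cK.
  apply/continuous_in_subspaceT => a; rewrite inE => /KU a0.
  apply: (@continuous_comp _ _ _ (coords : R[i]^o -> R * R)
    (fun p => cosh2 p o)).
    exact: continuous_coords.
  by apply: continuous_cosh2; rewrite gt_eqF.
exists (cosh2 (coords a) o).
  by apply: cosh2_ge2 => //; apply: KU; rewrite inE in aK.
by move=> b bK; apply: amax; rewrite inE.
Qed.

Lemma compact_of_coords_hdisc {R : realType} (T : R) :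
  compact (of_coords @` hdisc T).
Proof.
apply: continuous_compact; last exact: compact_hdisc.
exact/continuous_subspaceT/continuous_of_coords.
Qed.

(** * Roots of totally complex forms *)

(** [dehom F] with its coefficients kept real, which makes its invariance under
    conjugation and its values at real points immediate. *)
Definition rdehom {R : realType} (F : mpoly.mpoly 2 R) : {poly R} :=
  \sum_(m <- mpoly.msupp F) mpoly.mcoeff m F *: 'X^(m ord0).

Lemma dehomE {R : realType} (F : mpoly.mpoly 2 R) :
  dehom F = map_poly (real_complex R) (rdehom F).
Proof.
rewrite /dehom /subst_form /mpoly.mmap /rdehom rmorph_sum /=.
apply: eq_bigr => m _; rewrite map_polyZ map_polyXn /= -mul_polyC.
rewrite /mpoly.mmap1 !big_ord_recl big_ord0 /pair_point /=.
by rewrite expr1n !mulr1.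
Qed.

Lemma mevalE2 {R : realType} (F : mpoly.mpoly 2 R) (x z : R) :
  mpoly.meval (pair_point x z) F =
  \sum_(m <- mpoly.msupp F)
    mpoly.mcoeff m F * (x ^+ m ord0 * z ^+ m (lift ord0 ord0)).
Proof.
rewrite mpoly.mevalE; apply: eq_bigr => m _.
by rewrite !big_ord_recl big_ord0 /pair_point /= mulr1.
Qed.

Lemma mdeg2 (m : mpoly.multinom 2) :
  mpoly.mdeg m = (m ord0 + m (lift ord0 ord0))%N.
Proof. by rewrite mpoly.mdegE !big_ord_recl big_ord0 addn0. Qed.

Lemma horner_rdehom {R : realType} (F : mpoly.mpoly 2 R) (x : R) :
  (rdehom F).[x] = mpoly.meval (pair_point x 1) F.
Proof.
rewrite mevalE2 /rdehom horner_sum; apply: eq_bigr => m _.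
by rewrite hornerZ hornerXn expr1n mulr1.
Qed.

(** The coefficient of degree [N] is the value of the form at [(1, 0)], so the
    absence of a root at infinity makes the degree exactly [N]. *)
Lemma size_rdehom {R : realType} (N : nat) (F : mpoly.mpoly 2 R) :
  binary_form N F -> totally_complex F -> size (rdehom F) = N.+1.
Proof.
move=> /mpoly.dhomogP homF Fc.
have degF m : m \in mpoly.msupp F -> (m ord0 + m (lift ord0 ord0))%N = N.
  by move=> /homF; rewrite -mdeg2.
apply/eqP; rewrite eqn_leq; apply/andP; split.
  rewrite /rdehom big_seq; apply: (leq_trans (size_sum _ _ _)).
  apply/bigmax_leqP_seq => m mF _.
  rewrite (leq_trans (size_scale_leq _ _))// size_polyXn ltnS.
  by rewrite -(degF m mF) leq_addr.
have := Fc 1 0; rewrite xpair_eqE oner_eq0 => /(_ isT).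
apply: contraR; rewrite -leqNgt => /(nth_default 0) coefN.
rewrite mevalE2 -[X in _ == X]coefN /rdehom coef_sum !big_seq.
apply/eqP; apply: eq_bigr => m /degF <-.
rewrite coefZ coefXn -{3}[m ord0]addn0 eqn_add2l expr1n mul1r.
by case: (m _) => [|k] //=; rewrite ?expr0 // expr0n.
Qed.

Lemma conj_closed_perm {R : rcfType} (s : seq R[i]) :
    perm_eq (map conjc s) s -> {in s, forall a, complex.Im a != 0} ->
  perm_eq s ([seq a <- s | 0 < complex.Im a] ++
             map conjc [seq a <- s | 0 < complex.Im a]).
Proof.
move=> sJ s0; set P := fun a : R[i] => 0 < complex.Im a.
rewrite -(perm_filterC P s) perm_cat2l perm_sym.
rewrite -(permPr (perm_filter _ sJ)) filter_map.
rewrite (_ : [seq a <- s | P a] = [seq a <- s | preim conjc (predC P) a]) //.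
apply: eq_in_filter => -[x y] /s0 /= y0.
by rewrite /P /= -leNgt oppr_le0 lt_neqAle eq_sym y0.
Qed.

Lemma dehom_neq0 {R : realType} (N : nat) (F : mpoly.mpoly 2 R) :
  binary_form N F -> totally_complex F -> dehom F != 0.
Proof.
by move=> hF tF; rewrite dehomE map_poly_eq0 -size_poly_gt0 (size_rdehom N).
Qed.

Lemma complex_rootsE {R : realType} (F : mpoly.mpoly 2 R) :
  dehom F = lead_coef (dehom F) *: \prod_(z <- complex_roots F) ('X - z%:P).
Proof. by rewrite /complex_roots; case: closed_field_poly_normal. Qed.

Lemma root_dehom {R : realType} (F : mpoly.mpoly 2 R) (a : R[i]) :
  a \in complex_roots F -> root (dehom F) a.
Proof.
move=> aF; rewrite complex_rootsE /root hornerZ mulf_eq0; apply/orP; right.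
by rewrite -/(root _ _) root_prod_XsubC.
Qed.

Lemma size_complex_roots {R : realType} (N : nat) (F : mpoly.mpoly 2 R) :
  binary_form N F -> totally_complex F -> size (complex_roots F) = N.
Proof.
move=> hF tF; have /(congr1 (size \o polyseq)) /= := complex_rootsE F.
rewrite size_scale ?lead_coef_eq0 ?(dehom_neq0 N)// size_prod_XsubC.
by rewrite dehomE size_map_poly (size_rdehom N)// => -[].
Qed.

(** Conjugating the factorization of a polynomial with real coefficients gives
    another factorization of it. *)
Lemma conjc_complex_roots {R : realType} (N : nat) (F : mpoly.mpoly 2 R) :
    binary_form N F -> totally_complex F ->
  perm_eq (map conjc (complex_roots F)) (complex_roots F).
Proof.
move=> hF tF; have D0 := dehom_neq0 N F hF tF.
have DJ : map_poly conjc (dehom F) = dehom F.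
  rewrite dehomE -map_poly_comp; apply: eq_map_poly => x /=.
  by rewrite /= oppr0.
have L0 : lead_coef (dehom F) != 0 by rewrite lead_coef_eq0.
apply: prod_XsubC_eq.
apply: (scalerI L0); rewrite -complex_rootsE -[RHS]DJ.
rewrite {2}complex_rootsE map_polyZ /= rmorph_prod /= big_map.
have -> : conjc (lead_coef (dehom F)) = lead_coef (dehom F).
  by rewrite -[in RHS]DJ lead_coef_map.
by congr (_ *: _); apply: eq_bigr => z _; rewrite map_polyXsubC.
Qed.

Lemma complex_roots_Im {R : realType} (F : mpoly.mpoly 2 R) (a : R[i]) :
  totally_complex F -> a \in complex_roots F -> complex.Im a != 0.
Proof.
move=> tF /root_dehom; case: a => x y /=; apply: contraTneq => ->.
rewrite dehomE complexr0 /root horner_map fmorph_eq0 horner_rdehom.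
by apply: tF; rewrite xpair_eqE oner_eq0 andbF.
Qed.

Lemma perm_uhp_roots {R : realType} (N : nat) (F : mpoly.mpoly 2 R) :
    binary_form N F -> totally_complex F ->
  perm_eq (complex_roots F) (uhp_roots F ++ map conjc (uhp_roots F)).
Proof.
move=> hF tF; apply: conj_closed_perm; first exact: conjc_complex_roots hF tF.
by move=> a; exact: complex_roots_Im.
Qed.

Lemma size_uhp_roots {R : realType} (n : nat) (F : mpoly.mpoly 2 R) :
  binary_form (2 * n) F -> totally_complex F -> size (uhp_roots F) = n.
Proof.
move=> hF tF; have /perm_size := perm_uhp_roots _ _ hF tF.
rewrite (size_complex_roots _ _ hF tF) size_cat size_map addnn -mul2n.
by move/eqP; rewrite eqn_mul2l /= => /eqP.
Qed.

Lemma root_mult_count {R : realType} (N : nat) (F : mpoly.mpoly 2 R)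
    (a : R[i]) :
  binary_form N F -> totally_complex F ->
  root_mult F a = count_mem a (complex_roots F).
Proof.
move=> hF tF; rewrite /root_mult complex_rootsE -mul_polyC mupMr.
  exact: mu_prod_XsubC.
by rewrite rootC lead_coef_eq0 (dehom_neq0 N).
Qed.

(** If all [n] upper half-plane roots were [b], then [b] would be a root of
    multiplicity [n], half of the degree. *)
Lemma uhp_roots_not_constant {R : realType} (n : nat) (F : mpoly.mpoly 2 R) :
    binary_form (2 * n) F -> totally_complex F -> stable_form (2 * n) F ->
  forall b, exists2 a, a \in uhp_roots F & a != b.
Proof.
move=> hF tF [_ sF _] b; apply/hasP; apply: contraT; rewrite -all_predC => allb.
have := sF b; rewrite (root_mult_count _ _ _ hF tF) ltn_mul2l /=.
rewrite (permP (perm_uhp_roots _ _ hF tF)) count_cat.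
have -> : count_mem b (uhp_roots F) = n.
  rewrite -(size_uhp_roots _ _ hF tF); apply/eqP; rewrite -all_count.
  by apply: sub_all allb => a /=; rewrite negbK.
by rewrite ltnNge leq_addr.
Qed.

(** * Location of Julia's zero *)

Theorem proposition15 (R : realType) (n : nat) (K : set R[i]^o) :
  (3 <= n)%N -> compact K -> K `<=` @upper_half_plane R ->
  exists K' : set R[i]^o,
    [/\ compact K', K' `<=` @upper_half_plane R &
      forall F : mpoly 2 R,
        binary_form (2 * n) F -> totally_complex F -> stable_form (2 * n) F ->
        (size (uhp_roots F) < 2 * count (fun a => a \in K) (uhp_roots F))%N ->
        (@embed_H2_H3 R @` K') (xi_J F)].
Proof.
move=> n3 cK KU.
have [B B2 KB] := compact_cosh2_bounded K (0, 1) cK KU ltr01.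
have B1 : 1 <= B by apply: le_trans B2; rewrite ler1n.
pose T := B ^+ (2 * n).
have T2 : 2 <= T.
  by apply: le_trans B2 _; rewrite ler_eXnr// muln_gt0 (leq_trans _ n3).
have T0 : 0 < T by exact: lt_le_trans T2.
exists (of_coords @` hdisc T); split; first exact: compact_of_coords_hdisc.
  by move=> _ [p pT <-]; exact: hdisc_gt0 pT.
move=> F hF tF sF maj; set u := uhp_roots F in maj *.
have u0 : {in u, forall a, 0 < complex.Im a}.
  by move=> a; rewrite mem_filter => /andP[].
have coordsK : cancel coords (of_coords : R * R -> R[i]) by case.
have [||||||p pT pmin] := @cosh2_prod_min _ (map coords u)
  (fun p => of_coords p \in K) B T.
- by move=> _ /mapP[a /u0 a0 ->].
- by move=> _ /mapP[a _ ->]; rewrite coordsK inE => /KB.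
- exact: B1.
- rewrite size_map count_map; congr (_ < 2 * _)%N: maj.
  by apply: eq_count => a /=; rewrite coordsK.
- exact: T2.
- by rewrite size_map (size_uhp_roots _ _ hF tF).
have [wD wmin] := julia_min _ u p (perm_uhp_roots _ _ hF tF) u0
  (uhp_roots_not_constant _ _ hF tF sF) (hdisc_gt0 _ _ T0 pT) pmin.
exists (of_coords p); first by exists p.
apply/esym/xget_unique; first by split.
move=> w [w0 wmin']; apply: contrapT => wp.
have := lt_trans (wmin _ w0 wp) (wmin' _ wD (nesym wp)).
by rewrite ltxx.
Qed.
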